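(* For any odd prime $p$ with $p\equiv \pm 2\pmod 5$, we have $$\left(\frac{D_p(3,1)}{p}\right)=\begin{cases}\left(\frac{6}{p}\right)&\text{if } p\equiv 1\pmod 4,\\ 0&\text{if } p\equiv 3\pmod 4.\end{cases}$$
   Context: For an odd prime $p$, $\left(\frac{\cdot}{p}\right)$ denotes the Legendre symbol (equal to $0$ on multiples of $p$). For $b,c\in\mathbb{Z}$, $D_p(b,c)$ denotes the integer determinant of the $(p-1)\times(p-1)$ matrix with $(i,j)$ entry $(i^2+bij+cj^2)^{p-2}$: $$D_p(b,c)=\left|(i^2+bij+cj^2)^{p-2}\right|_{1\le i,j\le p-1}.$$ *)

(* Defs.v *)
From mathcomp Require Import all_boot all_order all_algebra.

Set Implicit Arguments.
Unset Strict Implicit.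
Unset Printing Implicit Defensive.

Import Order.TTheory GRing.Theory Num.Theory.

Local Open Scope ring_scope.

(* Only meant for p an odd prime.  Every integer is congruent mod p to some
   x < p, so letting x range over 'I_p loses no square root of a mod p. *)
Definition legendre (a : int) (p : nat) : int :=
  if (p%:Z %| a)%Z then 0
  else if [exists x : 'I_p, (x%:Z ^+ 2 == a %[mod p%:Z])%Z] then 1
  else -1.

(* Ordinals start at 0, hence the shift to row and column indices 1, ..., p - 1. *)
Definition Dp (p : nat) (b c : int) : int :=
  \det (\matrix_(i < p.-1, j < p.-1)
    ((i.+1%:Z ^+ 2 + b * i.+1%:Z * j.+1%:Z + c * j.+1%:Z ^+ 2) ^+ (p - 2))).

(* Main.v *)
Require Import Defs.
From mathcomp Require Import all_boot all_order all_algebra.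
From mathcomp Require Import all_field.
From mathcomp Require Import zify ring.

Import Order.TTheory GRing.Theory Num.Theory.

Local Open Scope ring_scope.

(** Put [f t = 1 / (t^2 + 3 t + 1)], which is defined on [F_p] because 5 is not
    a square modulo [p].  Modulo [p], the matrix has entries [f(i/j) / j^2], so
    expanding [f = \sum_k c_k t^k] over the characters of [F_p^*] factors it
    through a diagonal matrix, and its determinant is [\prod_k c_k].  If [a] is a
    root of [t^2 + 3 t + 1] in an extension of [F_p], then [a^p = a^-1] and
    [c_k = v_(k+2) / 5] with [v_n = a^n + a^-n], whence
    [D = v_2 v_3 ... v_p].  Since [v_(p+1-n) = v_n], the factors other than
    [v_p = v_1 = -3] and the middle one [v_m], [m = (p+1)/2], pair up into
    squares.  As [a^m = - (-1)^m], for [p = 1 mod 4] we get [v_m = 2] and [D] is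
    [-6] times a nonzero square, while for [p = 3 mod 4] some [v_n] vanishes. *)

(** * Reindexing of products, and the sequence [v_n] *)

Lemma big_nat_reflect (R : comNzRingType) (F : nat -> R) (a b c : nat) :
    (a <= b <= c.+1)%N ->
  \prod_(a <= i < b) F (c - i)%N = \prod_(c.+1 - b <= i < c.+1 - a) F i.
Proof.
case/andP; elim: b => [|b IHb].
  by rewrite leqn0 => /eqP-> _; rewrite !big_geq.
rewrite leq_eqVlt => /predU1P[-> _|lt_ab lt_bc]; first by rewrite !big_geq.
rewrite big_nat_recr // IHb ?(ltnW lt_bc) //.
rewrite subSS [RHS]big_ltn; last lia.
by rewrite mulrC -subSn.
Qed.

(** The pair is [(v_n, v_(n+1))], and the recurrence is that of the roots of [t^2 + 3 t + 1]. In
    terms of the usual Lucas numbers, [v_n = (-1)^n L_(2n)]. *)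
Fixpoint lucas_pair (n : nat) : int * int :=
  if n is n'.+1 then
    let: (a, b) := lucas_pair n' in (b, - 3 * b - a)
  else (2, - 3).

(* The integers [v_n = a^n + a^-n]. *)
Definition lucas (n : nat) : int := (lucas_pair n).1.

Lemma lucasSS (n : nat) : lucas n.+2 = - 3 * lucas n.+1 - lucas n.
Proof. by rewrite /lucas /=; case: (lucas_pair n). Qed.

Lemma lucasE (R : comNzRingType) (a b : R) (n : nat) :
  a + b = - 3%:R -> a * b = 1 -> (lucas n)%:~R = a ^+ n + b ^+ n.
Proof.
move=> ab_add ab_mul.
suff [] : (lucas n)%:~R = a ^+ n + b ^+ n /\
          (lucas n.+1)%:~R = a ^+ n.+1 + b ^+ n.+1 by [].
elim: n => [|n [IHn IHn1]]; first by split; rewrite ?expr0 ?expr1 ?ab_add.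
split=> //; rewrite lucasSS rmorphB rmorphM /= IHn IHn1.
have -> : (- 3)%:~R = a + b by rewrite ab_add.
by rewrite -[in X in _ - X](mul1r (_ + _)) -ab_mul !exprS; ring.
Qed.

(** By the recurrence, only boundary terms survive in the product. With [n = p - 1] and
    [t^(p-1) = 1] they collapse to a constant, so the sum inverts the quadratic up to a factor. *)
Lemma lucas_gen_sum (R : comNzRingType) (t : R) (n : nat) :
  (t ^+ 2 + 3%:R * t + 1) * \sum_(k < n) (lucas k.+2)%:~R * t ^+ k =
  7%:R + 3%:R * t - (lucas n.+2)%:~R * t ^+ n + (lucas n.+1)%:~R * t ^+ n.+1.
Proof.
elim: n => [|n IHn]; first by rewrite big_ord0 /lucas /=; ring.
rewrite big_ord_recr /= mulrDr IHn (lucasSS n.+1) rmorphB rmorphM /= !exprS.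
by ring.
Qed.

(** * Characteristic [p]: Wilson's theorem and character expansions *)

Section FieldOfCharacteristicP.

Variables (F : fieldType) (p : nat).
Hypotheses (p_prime : prime p) (p_odd : odd p) (charF : p \in [pchar F]).

Lemma pchar_natr_neq0 (n : nat) : (0 < n < p)%N -> n%:R != 0 :> F.
Proof.
by move=> /andP[n_gt0 lt_np]; rewrite -(dvdn_pcharf charF) gtnNdvd.
Qed.

Lemma exprp_natr (n : nat) : n%:R ^+ p = n%:R :> F.
Proof. exact: pFrobenius_aut_nat charF n. Qed.

Lemma exprp_add (x y : F) : (x + y) ^+ p = x ^+ p + y ^+ p.
Proof. exact: rmorphD (pFrobenius_aut charF) x y. Qed.

Lemma expr_pred_fixed (x : F) : x != 0 -> x ^+ p = x -> x ^+ p.-1 = 1.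
Proof.
move=> x_neq0; rewrite -[in X in X -> _](prednK (prime_gt0 p_prime)) exprS => xp.
by apply: (mulfI x_neq0); rewrite xp mulr1.
Qed.

Lemma Wilson_pchar : (p.-1)`!%:R = -1 :> F.
Proof.
have:= p_prime; rewrite Wilson ?prime_gt1 // (dvdn_pcharf charF) -natr1 addr_eq0.
exact: eqP.
Qed.

(** In [(p-1)!], replace each [i] above [p/2] by [-(p - i)]: the number of signs, [(p-1)/2], is even
    here. That [-1] is a square later turns [-6] into [6]. *)
Lemma sqrN1_pchar : (p = 1 %[mod 4])%N -> ((p./2)`!%:R : F) ^+ 2 = -1.
Proof.
move=> p_mod4; rewrite -Wilson_pchar !fact_prod !natr_prod.
have p_gt1 := prime_gt1 p_prime.
have le_hp : (p./2.+1 <= p)%N by lia.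
rewrite prednK ?prime_gt0 // [RHS](big_cat_nat (n := p./2.+1)) //= expr2.
congr (_ * _).
have -> : \prod_(p./2.+1 <= i < p) i%:R =
          \prod_(1 <= i < p./2.+1) (p - i)%:R :> F.
  rewrite (big_nat_reflect _ (fun i => i%:R)); last lia.
  by congr bigop; congr index_iota; lia.
have -> : \prod_(1 <= i < p./2.+1) (p - i)%:R =
          \prod_(1 <= i < p./2.+1) ((-1) * i%:R) :> F.
  apply: eq_big_nat => i /andP[_ lt_ih].
  by rewrite natrB ?(pcharf0 charF) ?sub0r ?mulN1r //; lia.
rewrite big_split /= prodr_const_nat subn1 /=.
have /dvdnP[k ->] : (2 %| p./2)%N by lia.
by rewrite mulnC exprM sqrrN !expr1n mul1r.
Qed.

Let x (i : 'I_p.-1) : F := i.+1%:R.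

Let x_neq0 i : x i != 0.
Proof. by apply: pchar_natr_neq0; have := ltn_ord i; lia. Qed.

Let xp1 i : x i ^+ p.-1 = 1.
Proof. exact: expr_pred_fixed (x_neq0 i) (exprp_natr _). Qed.

Lemma det_character_expansion (c : 'I_p.-1 -> F) :
  \det (\matrix_(i, j) \sum_(k < p.-1) c k * x i ^+ k * x j ^- k.+2) =
  \prod_k c k.
Proof.
pose V := \matrix_(i < p.-1, k < p.-1) x i ^+ k.
pose W := \matrix_(k < p.-1, j < p.-1) x j ^- k.+2.
have -> : \matrix_(i, j) \sum_(k < p.-1) c k * x i ^+ k * x j ^- k.+2 =
          V *m diag_mx (\row_k c k) *m W.
  apply/matrixP => i j; rewrite !mxE; apply: eq_bigr => k _.
  rewrite mul_mx_diag !mxE; congr (_ * _); exact: mulrC.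
(* Regrouping [det V] with [det W] avoids evaluating either Vandermonde-like determinant. *)
rewrite !det_mulmx det_diag mulrAC -det_mulmx.
(* Orthogonality: the geometric sum in [x i / x j] is [p - 1 = -1] on the diagonal and 0 off it. *)
have -> : V *m W = diag_mx (\row_j - x j ^- 2).
  apply/matrixP => i j; rewrite !mxE.
  transitivity ((\sum_(k < p.-1) (x i / x j) ^+ k) * x j ^- 2).
    rewrite mulr_suml; apply: eq_bigr => k _; rewrite !mxE expr_div_n -mulrA.
    by rewrite -invfM -exprD addn2.
  have [<-|neq_ij] := eqVneq i j.
    rewrite divff // (eq_bigr (fun=> 1)) => [|k _]; last exact: expr1n.
    rewrite sumr_const card_ord -subn1 natrB ?prime_gt0 // (pcharf0 charF).
    by rewrite sub0r mulN1r mulr1n.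
  rewrite mulr0n.
  have t_neq1 : x i / x j - 1 != 0.
    rewrite subr_eq0 -(inj_eq (mulIf (x_neq0 j))) divfK // mul1r -subr_eq0.
    have lt_xneq (i' j' : 'I_p.-1) : (j' < i')%N -> x i' - x j' != 0.
      by move=> lt_ji; rewrite -natrB ?pchar_natr_neq0 //; have := ltn_ord i'; lia.
    have [lt_ij|lt_ji|eq_ij] := ltngtP i j; last 1 first.
    - by case/eqP: neq_ij; apply: val_inj.
    - by rewrite -oppr_eq0 opprB lt_xneq.
    - exact: lt_xneq.
  suff -> : \sum_(k < p.-1) (x i / x j) ^+ k = 0 by rewrite mul0r.
  by apply: (mulfI t_neq1); rewrite mulr0 -subrX1 expr_div_n !xp1 divr1 subrr.
(* The product is [(-1)^(p-1) / ((p-1)!)^2], which is 1 by Wilson. *)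
rewrite det_diag [X in X * _](_ : _ = 1); last first.
  rewrite (eq_bigr (fun j => - ((x j)^-1 ^+ 2))) => [|j _]; last first.
    by rewrite mxE exprVn.
  rewrite prodrN prodrXl prodfV cardT size_enum_ord.
  have -> : \prod_j x j = -1.
    by rewrite -Wilson_pchar fact_prod natr_prod big_add1 /= big_mkord.
  rewrite exprVn sqrrN expr1n invr1 mulr1 -signr_odd.
  by have -> : odd p.-1 = false by lia.
by rewrite mul1r; apply: eq_bigr => k _; rewrite mxE.
Qed.

(** * The determinant as a product of [v_n], and its value *)

Section GoldenRatio.

Variable phi : F.
Hypotheses (phi2 : phi ^+ 2 = phi + 1) (phip : phi ^+ p = 1 - phi).

(** [a] and [b] are the roots of [t^2 + 3 t + 1]. Having the square root [phi] of [-a] at hand gives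
    [a^((p+1)/2)] from [phi^(p+1) = -1]. *)
Let a : F := - phi ^+ 2.
Let b : F := - (1 - phi) ^+ 2.
Let v n : F := (lucas n)%:~R.

Let ab_add : a + b = - 3%:R.
Proof. by rewrite /a /b; ring: phi2. Qed.

Let ab_mul : a * b = 1.
Proof.
have phiN : phi * (1 - phi) = -1 by ring: phi2.
by rewrite /a /b mulrNN -exprMn phiN sqrrN expr1n.
Qed.

Let vE n : v n = a ^+ n + b ^+ n.
Proof. exact: lucasE. Qed.

Let phipS : phi ^+ p.+1 = -1.
Proof. by rewrite exprS phip; ring: phi2. Qed.

(** Since [a^(p+1) = (phi^(p+1))^2 = 1], the reflection only exchanges [a^n] and [b^n = a^-n]. *)
Lemma lucas_reflect (n : nat) : (n <= p.+1)%N -> v (p.+1 - n) = v n.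
Proof.
move=> le_np; have ap1 : a ^+ p.+1 = 1.
  rewrite /a exprNn -exprM mulnC exprM phipS sqrrN expr1n mulr1 -signr_odd /=.
  by rewrite p_odd.
have bp1 : b ^+ p.+1 = 1 by rewrite -[LHS]mul1r -ap1 -exprMn ab_mul expr1n ap1.
have abn k : a ^+ k * b ^+ k = 1 by rewrite -exprMn ab_mul expr1n.
rewrite !vE addrC; congr (_ + _).
  by rewrite -[LHS]mul1r -(abn n) -mulrA -exprD subnKC // bp1 mulr1.
by rewrite -[LHS]mul1r -(abn n) mulrAC -exprD subnKC // ap1 mul1r.
Qed.

Let a_half : a ^+ (p.+1)./2 = - (-1) ^+ (p.+1)./2.
Proof.
rewrite /a [LHS]exprNn -exprM mul2n.
have -> : (p.+1./2.*2 = p.+1)%N by lia.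
by rewrite phipS mulrN1.
Qed.

Lemma lucas_eq0 (n : nat) : (v n == 0) = (a ^+ n.*2 == -1).
Proof.
have an_neq0 : a ^+ n != 0.
  apply: expf_neq0; apply/eqP=> a0.
  by have /eqP := ab_mul; rewrite a0 mul0r eq_sym oner_eq0.
rewrite vE -(inj_eq (mulfI an_neq0)) mulr0 mulrDr -(exprMn _ a b) ab_mul.
by rewrite expr1n -exprD addnn addr_eq0.
Qed.

Lemma det_lucas : 5%:R != 0 :> F -> (Dp p 3 1)%:~R = \prod_(2 <= n < p.+1) v n.
Proof.
move=> five_neq0; rewrite /Dp -det_map_mx.
(* The added denominators multiply to [5^(p-1) = 1]. *)
have -> : \prod_(2 <= n < p.+1) v n = \prod_(k < p.-1) (v k.+2 / 5%:R).
  rewrite big_split /= prodr_const card_ord exprVn.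
  rewrite expr_pred_fixed ?exprp_natr // invr1 mulr1.
  by rewrite !big_add1 big_mkord.
rewrite -det_character_expansion; congr (\det _); apply/matrixP => i j.
rewrite !mxE /= [LHS](rmorphXn (intmul 1)) /= !intrD !intrM.
rewrite -[LHS]/((x i * x i + 3%:R * x i * x j + 1 * (x j * x j)) ^+ (p - 2)).
rewrite mul1r -!expr2.
pose t := x i / x j.
have xiE : x i = t * x j by rewrite divfK.
have tp1 : t ^+ p.-1 = 1 by rewrite expr_div_n !xp1 divr1.
pose S := \sum_(k < p.-1) v k.+2 * t ^+ k.
(* By reflection [v_p = v_1 = -3] and [v_(p+1) = v_0 = 2], so the boundary terms reduce to
   [7 - 2 = 5]. *)
have S_E : (t ^+ 2 + 3%:R * t + 1) * S = 5%:R.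
  rewrite lucas_gen_sum exprS tp1 (prednK (prime_gt0 p_prime)).
  rewrite -/(v _) -/(v _) -[v p](lucas_reflect p) //.
  rewrite -[v p.+1](lucas_reflect p.+1) // subSnn subnn.
  by rewrite /v /lucas /=; ring.
set q := _ + _ * t + 1 in S_E.
have qE : x i ^+ 2 + 3%:R * x i * x j + x j ^+ 2 = q * x j ^+ 2.
  by rewrite xiE /q; ring.
have q_neq0 : q != 0.
  by apply: contraNneq five_neq0 => q0; rewrite -S_E q0 mul0r.
(* [q] is fixed by Frobenius, being built from [t] and integers; hence its power [p - 2] is its
   inverse. *)
have qp1 : q ^+ p.-1 = 1.
  apply: expr_pred_fixed => //.
  have tp : t ^+ p = t by rewrite expr_div_n !exprp_natr.
  by rewrite /q !exprp_add exprAC (exprMn _ 3%:R) tp exprp_natr expr1n.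
rewrite -[RHS](_ : (S / 5%:R) * x j ^- 2 = _); last first.
  rewrite !mulr_suml; apply: eq_bigr => k _.
  by rewrite /t expr_div_n -(addn2 k) exprD (invfM (x j ^+ k)); ring.
have expVp (z : F) : z != 0 -> z ^+ p.-1 = 1 -> z ^+ (p - 2) = z^-1.
  move=> z0 zp; apply: (mulIf z0); rewrite -exprSr mulVf // -zp.
  by congr (_ ^+ _); have := prime_gt1 p_prime; lia.
rewrite qE exprMn (expVp q) // (expVp (x j ^+ 2)) ?expf_neq0 //; last first.
  by rewrite exprAC xp1 expr1n.
congr (_ * _); rewrite -S_E invfM mulrCA divff ?mulr1 //.
by apply: contraNneq five_neq0 => S0; rewrite -S_E S0 mulr0.
Qed.

Lemma prod_lucas_1mod4 : (p = 1 %[mod 4])%N ->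
  \prod_(2 <= n < p.+1) v n = - 6%:R * (\prod_(2 <= n < p.+1./2) v n) ^+ 2.
Proof.
move=> p_mod4; have p_gt1 := prime_gt1 p_prime.
have p_neq3 : p != 3 by apply: contraPneq p_mod4 => ->.
set m := p.+1./2; have pE : p = m.*2.-1 by rewrite /m; lia.
have m_odd : odd m by rewrite /m; lia.
have vm : v m = 2%:R.
  have am : a ^+ m = 1 by rewrite a_half -signr_odd m_odd opprK.
  have bm : b ^+ m = 1 by rewrite -[LHS]mul1r -am -exprMn ab_mul expr1n am.
  by rewrite vE am bm.
rewrite big_nat_recr /=; last lia.
rewrite (big_cat_nat (n := m)) /=; [|lia..].
rewrite [X in _ * X * _]big_ltn; last lia.
(* The factors above [m] mirror those below; the mirror image of [v_p] is [v_1], outside the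
   range. *)
have <- : \prod_(2 <= n < m) v n = \prod_(m.+1 <= n < p) v n.
  rewrite [LHS](_ : _ = \prod_(2 <= n < m) v (p.+1 - n)%N); last first.
    by apply: eq_big_nat => n lt_nm; rewrite lucas_reflect //; lia.
  rewrite big_nat_reflect; last lia.
  by congr bigop; congr index_iota; lia.
have -> : v p = - 3%:R.
  by rewrite -lucas_reflect // subSnn.
by rewrite vm; ring.
Qed.

(** If [v_n = 0] then [a^(2n) = -1]; raising to the odd power [m = (p+1)/2], where [a^m = 1], would
    give [1 = -1]. *)
Lemma prod_lucas_neq0 : (p = 1 %[mod 4])%N ->
  \prod_(2 <= n < p.+1./2) v n != 0.
Proof.
move=> p_mod4; rewrite prodf_seq_neq0; apply/allP => n _ /=.
set m := p.+1./2; have m_odd : odd m by rewrite /m; lia.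
rewrite lucas_eq0; apply/eqP => an.
have am : a ^+ m = 1 by rewrite a_half -signr_odd m_odd opprK.
have /eqP : (a ^+ n.*2) ^+ m = 1 by rewrite exprAC am expr1n.
rewrite an -signr_odd m_odd expr1 eq_sym -addr_eq0.
by apply/negP; apply: (pchar_natr_neq0 2); have := prime_gt1 p_prime; lia.
Qed.

Lemma prod_lucas_3mod4 : (p = 3 %[mod 4])%N -> \prod_(2 <= n < p.+1) v n = 0.
Proof.
move=> p_mod4; have p_gt1 := prime_gt1 p_prime.
(* Here [2n = 3m] with [m = (p+1)/2] even, so [a^(2n) = (-1)^3]. The simpler choice [(p+1)/4] falls
   below the range when [p = 3]. *)
pose n := (3 * p.+1 %/ 4)%N.
apply/eqP; rewrite prodf_seq_eq0; apply/hasP; exists n.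
  by rewrite mem_index_iota /n; lia.
rewrite /= lucas_eq0 (_ : n.*2 = p.+1./2 * 3)%N; last by rewrite /n; lia.
rewrite exprM a_half -signr_odd (_ : odd p.+1./2 = false); last by lia.
by rewrite expr0 -signr_odd expr1.
Qed.

End GoldenRatio.

(* For a primitive fifth root of unity [z], the Gauss periods [z ^+ 2 + z ^+ 3]
   and [z + z ^+ 4] are the opposites of the golden ratios, and the Frobenius
   map swaps them because [p] is not a square modulo 5. *)
Lemma golden_ratio_pchar (z : F) : (p %% 5 = 2 \/ p %% 5 = 3)%N ->
    z ^+ 4 + z ^+ 3 + z ^+ 2 + z + 1 = 0 ->
  exists2 phi : F, phi ^+ 2 = phi + 1 & phi ^+ p = 1 - phi.
Proof.
move=> p_mod5 z_root; pose phi := - (z ^+ 2 + z ^+ 3).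
have z4 : z ^+ 4 = - (z ^+ 3 + z ^+ 2 + z + 1).
  by apply/eqP; rewrite -addr_eq0 !addrA z_root.
have z5 : z ^+ 5 = 1 by ring: z4.
exists phi; first by rewrite /phi; ring: z4.
have zp : z ^+ p = z ^+ (p %% 5).
  by rewrite [in LHS](divn_eq p 5) exprD mulnC exprM z5 expr1n mul1r.
rewrite /phi exprNn -signr_odd p_odd expr1 mulN1r exprp_add.
rewrite ![(z ^+ _) ^+ p]exprAC zp.
by case: p_mod5 => ->; ring: z4.
Qed.

End FieldOfCharacteristicP.

(** * Passage to an extension field, and return to Legendre symbols *)

Lemma fifth_root_extension (p : nat) : prime p ->
  exists (F : fieldType) (z : F),
    p \in [pchar F] /\ z ^+ 4 + z ^+ 3 + z ^+ 2 + z + 1 = 0.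
Proof.
move=> p_prime; pose q : {poly 'F_p} := Poly [:: 1; 1; 1; 1; 1].
have szq : size q = 5%N by rewrite (PolyK (c := 0)) //= oner_neq0.
have q_neq0 : q != 0 by rewrite -size_poly_gt0 szq.
have [L [rs q_split _]] := FinSplittingFieldFor q_neq0.
have szL : size (map_poly (GRing.in_alg L) q) = 5%N by rewrite size_map_poly.
case: rs q_split => [|z rs] q_split.
  by have := eqp_size q_split; rewrite szL big_nil size_poly1.
exists L, z; split; first by rewrite pchar_lalg pchar_Fp.
have /rootP : root (map_poly (GRing.in_alg L) q) z.
  by rewrite (eqp_root q_split) root_prod_XsubC mem_head.
rewrite map_Poly horner_Poly /= scale1r => <-.
by ring.
Qed.

Lemma legendreE (p : nat) (a : int) : prime p ->
  legendre a p = if a%:~R == 0 :> 'F_p then 0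
                 else if [exists y : 'F_p, y ^+ 2 == a%:~R] then 1 else -1.
Proof.
move=> p_prime; rewrite /legendre (dvdz_pcharf (pchar_Fp p_prime)).
case: ifP => // _; congr (if _ then _ else _).
have sqE (n : nat) : (n%:Z ^+ 2 == a %[mod p%:Z])%Z = (n%:R ^+ 2 == a%:~R :> 'F_p).
  rewrite eqz_mod_dvd (dvdz_pcharf (pchar_Fp p_prime)) rmorphB rmorphXn subr_eq0.
  by rewrite pmulrn.
apply/existsP/existsP => [[n]|[y]]; first by rewrite sqE; exists n%:R.
have lt_yp : (y < p)%N by rewrite -[X in (_ < X)%N](Fp_cast p_prime).
by exists (Ordinal lt_yp); rewrite sqE /= natr_Zp.
Qed.

Lemma legendre_mul_sqr (p : nat) (a b : int) (u : 'F_p) : prime p ->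
  u != 0 -> a%:~R = b%:~R * u ^+ 2 -> legendre a p = legendre b p.
Proof.
move=> p_prime u_neq0 abE; rewrite !legendreE // abE.
rewrite mulf_eq0 expf_eq0 /= (negPf u_neq0) orbF; case: ifP => // _.
congr (if _ then _ else _); apply/existsP/existsP => [[y /eqP yE]|[y /eqP <-]].
  by exists (y / u); rewrite expr_div_n yE mulfK ?expf_neq0.
by exists (y * u); rewrite exprMn.
Qed.

Theorem corollary2p3 (p : nat) (p_prime : prime p) (p_odd : odd p)
    (p_mod5 : (p%:Z = 2 %[mod 5])%Z \/ (p%:Z = - 2 %[mod 5])%Z) :
  ((p = 1 %[mod 4])%N -> legendre (Dp p 3 1) p = legendre 6 p) /\
  ((p = 3 %[mod 4])%N -> legendre (Dp p 3 1) p = 0).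
Proof.
have {}p_mod5 : (p %% 5 = 2 \/ p %% 5 = 3)%N by lia.
have [F [z [charF z_root]]] := fifth_root_extension p p_prime.
have [phi phi2 phip] := golden_ratio_pchar F p p_odd charF z p_mod5 z_root.
have five_neq0 : 5%:R != 0 :> F.
  rewrite -(dvdn_pcharf charF) dvdn_prime2 //.
  by apply/eqP => p5; rewrite p5 in p_mod5; case: p_mod5.
have DE := det_lucas F p p_prime p_odd charF phi phi2 phip five_neq0.
(* Equality of integer images in [F] is congruence mod [p], so it descends to ['F_p]. *)
have intF (m n : int) : m%:~R = n%:~R :> F -> m%:~R = n%:~R :> 'F_p.
  move/eqP; rewrite -subr_eq0 -rmorphB -(dvdz_pcharf charF).
  by rewrite (dvdz_pcharf (pchar_Fp p_prime)) rmorphB subr_eq0 => /eqP.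
split=> p_mod4; last first.
  rewrite (prod_lucas_3mod4 F p p_prime p_odd charF phi phi2 phip) // in DE.
  by rewrite /legendre (dvdz_pcharf charF) DE eqxx.
rewrite (prod_lucas_1mod4 F p p_prime p_odd charF phi phi2 phip) // in DE.
have w_neq0 := prod_lucas_neq0 F p p_prime p_odd charF phi phi2 phip p_mod4.
(* The square root must lie in the prime field, hence the integer product. *)
pose w := \prod_(2 <= n < p.+1./2) lucas n.
have wE : w%:~R = \prod_(2 <= n < p.+1./2) (lucas n)%:~R :> F.
  exact: rmorph_prod.
have {}DE : (Dp p 3 1)%:~R = (- 6 * w ^+ 2)%:~R :> 'F_p.
  by apply: intF; rewrite DE -wE rmorphM rmorphXn.
have wFp_neq0 : w%:~R != 0 :> 'F_p.
  by rewrite -(dvdz_pcharf (pchar_Fp p_prime)) (dvdz_pcharf charF) wE.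
have i2 := sqrN1_pchar 'F_p p p_prime p_odd (pchar_Fp p_prime) p_mod4.
(* The factorial is a square root of [-1], so [-6 w^2] is 6 times a square. *)
apply: (legendre_mul_sqr _ _ _ (p./2`!%:R * w%:~R)) => //.
  rewrite mulf_neq0 //; apply: contra_eq_neq i2 => ->.
  by rewrite expr0n eq_sym oppr_eq0 oner_neq0.
by rewrite DE exprMn i2 rmorphM rmorphXn rmorphN mulN1r mulNr mulrN.
Qed.
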